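(* Let $\mathfrak s$ be a symmetry jet on a manifold $M$, and let $\nabla=\nabla^{\mathfrak s}$ be the corresponding affine connection, with torsion $T^\nabla$. Then for all $x\in M$, $X_x,Y_x\in T_xM$, $$T^\nabla(X_x,Y_x)=\tfrac12\,\pi\bigl(\kappa(\mathfrak s(x))\cdot\mathcal X,\;\mathfrak s(x)\cdot\mathcal X\bigr)$$ for any $\mathcal X\in T^2M$ with $p(\mathcal X)=Y_x$ and $p_*(\mathcal X)=X_x$.
   Context: All objects are smooth. $\mathcal B^{(1)}$ is the Lie groupoid over $M$ of linear isomorphisms $\xi:T_xM\to T_yM$, source $\alpha(\xi)=x$, target $\beta(\xi)=y$; $-I_x=-\mathrm{id}_{T_xM}$. A local bisection of $\mathcal B^{(1)}$ is a section $b:U\to\mathcal B^{(1)}$ of $\alpha$ over an open $U$ with $b^0:=\beta\circ b$ a diffeomorphism onto an open set. A $(1,1)$-jet is the $1$-jet $j^1_xb$ of such a $b$; $p(j^1_xb)=b(x)$, $p_*(j^1_xb)=(b^0)_{*_x}$; $\mathcal B^{(1,1)}_{sh}$ is the set of those with $p=p_*$. A symmetry jet is a smooth section $\mathfrak s:M\to\mathcal B^{(1,1)}_{sh}$, $\mathfrak s(x)$ being a jet at $x$ with $p(\mathfrak s(x))=-I_x$. With $(bY)_{b^0(x')}=b(x')Y_{x'}$, the corresponding connection is $(\nabla^{\mathfrak s}_XY)_x=\frac12[X,Y+s_xY]_x$ where $\mathfrak s(x)=j^1_xs_x$. Second tangent bundle: a chart of $M$ induces coordinates $(x,X,Y,V)$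 on $T^2M=T(TM)$, the point being the vector with components $(Y,V)$ at $(x,X)\in TM$. Then $p(x,X,Y,V)=(x,X)$, $p_*(x,X,Y,V)=(x,Y)$ (the differential of $TM\to M$), and $\kappa(x,X,Y,V)=(x,Y,X,V)$ is the canonical involution. If $\mathcal X_1=(x,X,Y,V_1)$, $\mathcal X_2=(x,X,Y,V_2)$ have the same images under $p$ and $p_*$, $\pi(\mathcal X_1,\mathcal X_2)\in T_xM$ is the (chart-independent) vector with components $V_1-V_2$. A $(1,1)$-jet $j^1_xb$ acts on $T^2M$ over $x$ by $j^1_xb\cdot\frac{dX_t}{dt}|_{0}=\frac{d}{dt}\bigl(b(x_t)X_t\bigr)|_{0}$, where $X_t\in T_{x_t}M$, $x_0=x$. For $\eta\in\mathcal B^{(1,1)}_{sh}$, $\kappa(\eta)\in\mathcal B^{(1,1)}_{sh}$ is determined by $\kappa(\eta)\cdot\mathcal X=\kappa(\eta\cdot\kappa(\mathcal X))$. Torsion: $T^\nabla(X,Y)=\nabla_XY-\nabla_YX-[X,Y]$. *)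

(* Defs.v *)
From HB Require Import structures.
From mathcomp Require Import all_boot all_order all_algebra.
From mathcomp Require Import all_classical all_reals topology normedtype derive.

Set Implicit Arguments.
Unset Strict Implicit.
Unset Printing Implicit Defensive.

Import Order.TTheory GRing.Theory Num.Theory numFieldNormedType.Exports.
Local Open Scope classical_set_scope.
Local Open Scope ring_scope.

(* C^k and C^oo maps on an open set [U] of a finite-dimensional space: all
   iterated directional derivatives exist and are continuous on [U].          *)
Fixpoint Ck (R : realType) (V W : normedModType R) (k : nat)
    (U : set V) (f : V -> W) : Prop :=
  if k is k'.+1 then
    (forall u, U u -> differentiable f u) /\ (forall v, Ck k' U ('D_v f))
  else forall u, U u -> {for u, continuous f}.

Definition smooth (R : realType) (V W : normedModType R)
    (U : set V) (f : V -> W) : Prop := forall k, Ck k U f.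

(* [cinv] is total; it is only meaningful on the open set [cmap @` cdom].     *)
Record chart (R : realType) (n : nat) (M : topologicalType) := Chart {
  cdom : set M;
  cmap : M -> 'rV[R]_n;
  cinv : 'rV[R]_n -> M;
  open_cdom : open cdom;
  open_cimg : open (cmap @` cdom);
  cmapK : forall x, cdom x -> cinv (cmap x) = x;
  cmap_cts : forall x, cdom x -> {for x, continuous cmap};
  cinv_cts : forall u, (cmap @` cdom) u -> {for u, continuous cinv} }.

(* Smooth manifolds of dimension n; the smooth structure is given by a (not
   necessarily maximal) smooth atlas.                                         *)
Record manifold (R : realType) (n : nat) := Manifold {
  mcarrier :> topologicalType;
  atlas : set (chart R n mcarrier);
  atlas_cover : forall x, exists phi, atlas phi /\ cdom phi x;
  atlas_smooth : forall phi psi, atlas phi -> atlas psi ->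
    smooth (cmap phi @` (cdom phi `&` cdom psi)) (cmap psi \o cinv phi);
  mfld_hausdorff : hausdorff_space mcarrier;
  mfld_second_countable : @second_countable mcarrier }.

Section Manifold.
Variables (R : realType) (n : nat) (M : manifold R n).

Local Notation chartM := (chart R n M).

Definition chart_at (x : M) : chartM := projT1 (cid (atlas_cover x)).

(* The Jacobian at x of the change of coordinates from phi to psi.  Vectors are
   rows, so matrices act on them from the right.                              *)
Definition trans (phi psi : chartM) (x : M) : 'M[R]_n :=
  'J (cmap psi \o cinv phi) (cmap phi x).

(* A tangent vector at x is represented by its components in [chart_at x];
   its components in any other chart phi around x are given by [comp phi].    *)
Definition tangent (x : M) : Type := 'rV[R]_n.

Definition comp (phi : chartM) (x : M) (v : tangent x) : 'rV[R]_n :=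
  v *m trans (chart_at x) phi x.

Record TM := TVec { tbase : M; tvec : tangent tbase }.
Arguments TVec : clear implicits.

(* Smoothness on an open subset V of the domain of phi, read in phi.          *)
Definition smooth_in (W : normedModType R) (phi : chartM) (V : set M)
    (g : M -> W) : Prop := smooth (cmap phi @` V) (g \o cinv phi).

Definition smooth_map (U : set M) (f : M -> M) : Prop :=
  forall x, U x -> exists phi psi V,
    [/\ atlas phi, atlas psi, open V & V x] /\
    [/\ V `<=` U `&` cdom phi, f @` V `<=` cdom psi &
        smooth_in phi V (cmap psi \o f)].

(* Vector fields defined (and smooth) on U; values outside U are irrelevant.  *)
Definition smooth_field (U : set M) (X : forall x, tangent x) : Prop :=
  forall x, U x -> exists phi V,
    [/\ atlas phi, open V, V x, V `<=` U `&` cdom phi &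
        smooth_in phi V (fun y => comp phi (X y))].

Definition field_at (x : M) (X : forall x, tangent x) : Prop :=
  exists U, [/\ open U, U x & smooth_field U X].

Definition bracket (X Y : forall x, tangent x) (x : M) : tangent x :=
  let phi := chart_at x in
  let read (Z : forall x, tangent x) u := comp phi (Z (cinv phi u)) in
  let u0 := cmap phi x in
  'D_(read X u0) (read Y) u0 - 'D_(read Y u0) (read X) u0.

(* The groupoid B^(1) of linear isomorphisms T_xM -> T_yM; xi maps
   v : tangent (iso_src xi) to v *m iso_mx xi : tangent (iso_tgt xi).         *)
Record B1 := Iso {
  iso_src : M;
  iso_tgt : M;
  iso_mx : 'M[R]_n;
  iso_unit : iso_mx \in unitmx }.

Fact opp_unit : - 1%:M \in @unitmx R n.
Proof. by rewrite -scaleN1r scalemx1 unitmxE det_scalar unitrX ?unitrN1. Qed.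

Definition negI (x : M) : B1 := Iso x x opp_unit.

(* The matrix of xi with respect to the components in phi at the source and
   in psi at the target.                                                      *)
Definition iso_comp (phi psi : chartM) (xi : B1) : 'M[R]_n :=
  trans phi (chart_at (iso_src xi)) (iso_src xi) *m iso_mx xi *m
  trans (chart_at (iso_tgt xi)) psi (iso_tgt xi).

Definition smooth_iso_section (U : set M) (b : M -> B1) : Prop :=
  forall x, U x -> exists phi psi V,
    [/\ atlas phi, atlas psi, open V & V x] /\
    [/\ V `<=` U `&` cdom phi,
        (iso_tgt \o b) @` V `<=` cdom psi,
        smooth_in phi V (cmap psi \o iso_tgt \o b) &
        smooth_in phi V (iso_comp phi psi \o b)].

(* [bis] and [binv] are total; they are only meaningful on [bdom] and on its
   image under [b^0].                                                         *)
Record bisection := Bisection {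
  bdom : set M;
  bis :> M -> B1;
  binv : M -> M;
  bdom_open : open bdom;
  bis_src : forall x, bdom x -> iso_src (bis x) = x;
  bis_smooth : smooth_iso_section bdom bis;
  bimg_open : open ((iso_tgt \o bis) @` bdom);
  bisK : forall x, bdom x -> binv (iso_tgt (bis x)) = x;
  binv_smooth : smooth_map ((iso_tgt \o bis) @` bdom) binv }.

Definition b0 (b : bisection) (x : M) : M := iso_tgt (b x).

(* (bY)_{b^0(x')} = b(x') Y_{x'}                                              *)
Definition push (b : bisection) (Y : forall x, tangent x) (z : M) : tangent z :=
  Y (binv b z) *m iso_mx (b (binv b z)).

Definition read_b0 (phi psi : chartM) (b : bisection) (u : 'rV[R]_n) :=
  cmap psi (b0 b (cinv phi u)).

Definition read_iso (phi psi : chartM) (b : bisection) (u : 'rV[R]_n) :=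
  iso_comp phi psi (b (cinv phi u)).

(* Equality of 1-jets at x of maps into B^(1).                                *)
Definition jet_eq (x : M) (b b' : bisection) : Prop :=
  [/\ bdom b x, bdom b' x, b x = b' x &
      let phi := chart_at x in let psi := chart_at (b0 b x) in
      let u0 := cmap phi x in
      forall v, 'D_v (read_b0 phi psi b) u0 = 'D_v (read_b0 phi psi b') u0 /\
                'D_v (read_iso phi psi b) u0 = 'D_v (read_iso phi psi b') u0].

(* A (1,1)-jet j^1_x b is an equivalence class of local bisections.           *)
Record jet11 := Jet {
  jsrc : M;
  jcls : set bisection;
  jclsP : exists b, bdom b jsrc /\ jcls = jet_eq jsrc b }.

HB.instance Definition _ := gen_eqMixin jet11.
HB.instance Definition _ := gen_choiceMixin jet11.

Definition j1 (b : bisection) (x : M) (bx : bdom b x) : jet11 :=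
  Jet (ex_intro _ b (conj bx erefl)).

(* A representative: eta = j^1_x (jrep eta) with x = jsrc eta.                *)
Definition jrep (eta : jet11) : bisection := projT1 (cid (jclsP eta)).

Definition jp (eta : jet11) : B1 := jrep eta (jsrc eta).

(* The differential of b^0 at x, as a matrix T_xM -> T_{b^0(x)}M.             *)
Definition jpstar (eta : jet11) : 'M[R]_n :=
  let x := jsrc eta in let b := jrep eta in
  'J (read_b0 (chart_at x) (chart_at (b0 b x)) b) (cmap (chart_at x) x).

(* Membership in B^(1,1)_sh; p(eta) and p_*(eta) always have the same source
   and target, so that p = p_* amounts to an equality of matrices.            *)
Definition semiholonomic (eta : jet11) : Prop := iso_mx (jp eta) = jpstar eta.

(* Smoothness of a section of B^(1,1) -> M, in the coordinates (target, matrix,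
   and first derivatives of both) of jets induced by two charts.              *)
Definition smooth_jet_section (s : M -> jet11) : Prop :=
  forall x, exists phi psi V,
    [/\ atlas phi, atlas psi, open V & V x] /\
    [/\ V `<=` cdom phi, (iso_tgt \o jp \o s) @` V `<=` cdom psi,
        smooth_in phi V (cmap psi \o iso_tgt \o jp \o s),
        smooth_in phi V (iso_comp phi psi \o jp \o s) &
        forall v,
          smooth_in phi V
            (fun y => 'D_v (read_b0 phi psi (jrep (s y))) (cmap phi y)) /\
          smooth_in phi V
            (fun y => 'D_v (read_iso phi psi (jrep (s y))) (cmap phi y))].

Record symmetry_jet := SymmetryJet {
  sym :> M -> jet11;
  sym_src : forall x, jsrc (sym x) = x;
  sym_semiholonomic : forall x, semiholonomic (sym x);
  sym_negI : forall x, jp (sym x) = negI x;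
  sym_smooth : smooth_jet_section sym }.

Definition nabla (s : symmetry_jet) (X Y : forall x, tangent x) (x : M) :
    tangent x :=
  2^-1 *: bracket X (fun z => Y z + push (jrep (s x)) Y z) x.

(* The torsion tensor: the value of D_X Y - D_Y X - [X, Y] at x, for vector
   fields X and Y near x extending v and w.                                   *)
Definition torsion
    (D : (forall x, tangent x) -> (forall x, tangent x) -> forall x, tangent x)
    (x : M) (v w : tangent x) : tangent x :=
  xget 0 [set t | exists X Y, [/\ field_at x X, field_at x Y, X x = v, Y x = w &
                                  t = D X Y x - D Y X x - bracket X Y x]].

(* T^2M = T(TM): the vector with components (ttY, ttV) at (ttbase, ttX) in TM,
   in the chart of TM induced by [chart_at ttbase].                           *)
Record TTM := TTVec {
  ttbase : M;
  ttX : tangent ttbase;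
  ttY : tangent ttbase;
  ttV : 'rV[R]_n }.
Arguments TTVec : clear implicits.

HB.instance Definition _ := gen_eqMixin TTM.
HB.instance Definition _ := gen_choiceMixin TTM.

Definition ttp (XX : TTM) : TM := TVec (ttbase XX) (ttX XX).
Definition ttpstar (XX : TTM) : TM := TVec (ttbase XX) (ttY XX).
Definition ttkappa (XX : TTM) : TTM := TTVec (ttbase XX) (ttY XX) (ttX XX) (ttV XX).

(* Only meaningful when the arguments have the same images under [ttp] and
   [ttpstar].                                                                 *)
Definition ttpi (X1 X2 : TTM) : tangent (ttbase X1) := ttV X1 - ttV X2.

Definition smooth_curve (c : R -> TM) : Prop :=
  let phi := chart_at (tbase (c 0)) in
  exists e : R, [/\ 0 < e,
    forall t, ball 0 e t -> cdom phi (tbase (c t)),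
    smooth (ball (0 : R) e) (fun t => cmap phi (tbase (c t))) &
    smooth (ball (0 : R) e) (fun t => comp phi (tvec (c t)))].

Definition velocity (c : R -> TM) : TTM :=
  let phi := chart_at (tbase (c 0)) in
  TTVec (tbase (c 0)) (tvec (c 0))
        (derive1 (fun t => cmap phi (tbase (c t))) 0)
        (derive1 (fun t => comp phi (tvec (c t))) 0).

Definition bact (b : bisection) (v : TM) : TM :=
  TVec (b0 b (tbase v)) (tvec v *m iso_mx (b (tbase v))).

(* j^1_x b . (dX_t/dt)(0) = (d(b(x_t) X_t)/dt)(0), for arguments over x.      *)
Definition jact (eta : jet11) (XX : TTM) : TTM :=
  xget XX [set ZZ | exists c, [/\ smooth_curve c, velocity c = XX &
                                  velocity (bact (jrep eta) \o c) = ZZ]].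

Definition jkappa (eta : jet11) : jet11 :=
  xget eta [set eta' | [/\ jsrc eta' = jsrc eta, semiholonomic eta' &
    forall XX, ttbase XX = jsrc eta ->
      jact eta' XX = ttkappa (jact eta (ttkappa XX))]].

End Manifold.

Arguments TVec {R n M} tbase tvec.
Arguments TTVec {R n M} ttbase ttX ttY ttV.

(* Main.v *)
Require Import Defs.
From HB Require Import structures.
From mathcomp Require Import all_boot all_order all_algebra perm.
From mathcomp Require Import all_classical all_reals interval_inference.
From mathcomp Require Import topology normedtype landau derive.
Import Order.TTheory GRing.Theory Num.Theory numFieldNormedType.Exports.
Local Open Scope classical_set_scope.
Local Open Scope ring_scope.

Set Implicit Arguments.
Unset Strict Implicit.
Unset Printing Implicit Defensive.

(** Everything is computed in the chart phi = [chart_at x].  Let b be a bisection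
    representing the jet at x of the symmetry jet.  Since p = p_* = -I_x, the
    base map of b fixes x and its first derivative there is -1, so that the only
    free part of the jet is the derivative beta(v) at x, in the direction v, of
    the matrix of b.  This derivative is [iso_jet].

    Action on T^2M.  Differentiating the components of b(x_t) X_t by the product
    rule gives ([velocity_bact], [jactE], [prolong_reflects])
      s(x) . (x, X, Y, V) = (x, -X, -Y, -V + X beta(Y)).
    Conjugating with kappa exchanges the two middle components, whence
      kappa(s(x)) . (x, X, Y, V) = (x, -X, -Y, -V + Y beta(X)),
    and pi of the two results is Y beta(X) - X beta(Y).  That kappa(s(x)) really
    is a (1,1)-jet has to be proved: [exists_reflection] builds a bisection,
    the point reflection of the chart combined with a matrix that is affine in
    the coordinates, whose matrix derivative at x is any prescribed linear map.
    With the derivative beta' determined by X beta'(Y) = Y beta(X), its jet has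
    the property that defines kappa(s(x)) ([jkappa_exists], [jkappaE]).

    Torsion.  The field s_x Y is, near x, the product of Y with the matrix of b,
    both evaluated at the preimage under the base map, whose derivative is again
    -1.  Hence s_x Y takes the value -Y at x, and its derivative in the direction
    X is D_X Y - Y beta(X) ([derive_push]).  In [X, Y + s_x Y] the term that
    differentiates X drops out because Y + s_x Y vanishes at x, so
      nabla_X Y = D_X Y - (1/2) Y beta(X)
    ([nablaE]).  Antisymmetrizing, the flat parts cancel against the bracket, and
    T(X, Y) = (1/2) (X beta(Y) - Y beta(X)) ([torsionE]).  For a point of T^2M
    with p-image Y and p_*-image X, this is half of the value of pi above. *)

(** * Differential calculus of matrix-valued maps *)

Section Calculus.
Variable R : realType.

(** The remainder term of the differential depends only on the germ of the map.
    Chart formulas hold only near a point, so they are compared through this lemma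
    and its analogue for the Jacobian. *)
Lemma near_eq_differentiable (V W : normedModType R) (f g : V -> W) a :
  (\near a, f a = g a) -> differentiable f a -> differentiable g a.
Proof.
move=> fg df; have fga : f a = g a by exact: nbhs_singleton fg.
have dg : g \o shift a = cst (g a) + 'd f a +o_ 0 id.
  apply/eqaddoP => _/posnumP[e].
  have /eqaddoP/(_ e%:num (gt0 e)) := diff_locally df.
  have : \forall h \near 0, f (shift a h) = g (shift a h).
    by have := fg; rewrite (near_shift 0 a)/=; apply: filterS => h; rewrite subr0.
  by apply: filterS2 => h /=; rewrite !fctE /= -fga => <-.
have dgf : 'd g a = 'd f a :> (V -> W).
  by apply: diff_unique => //; exact: diff_continuous.
by apply/diff_locallyP; rewrite dgf; split => //; exact: diff_continuous.
Qed.

Lemma derive_comp (U V W : normedModType R) (f : U -> V) (g : V -> W) a v :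
  differentiable f a -> differentiable g (f a) ->
  'D_v (g \o f) a = 'D_('D_v f a) g (f a).
Proof.
move=> df dg; rewrite (deriveE _ (differentiable_comp df dg)) diff_comp //=.
by rewrite -deriveE // -deriveE.
Qed.

Lemma jacobian_comp n m p (f : 'rV[R]_n -> 'rV[R]_m) (g : 'rV[R]_m -> 'rV[R]_p)
    a : differentiable f a -> differentiable g (f a) ->
  'J (g \o f) a = 'J f a *m 'J g (f a).
Proof.
move=> df dg; apply/row_matrixP => i; rewrite [LHS]rowE [RHS]rowE mulmxA.
rewrite -[LHS](deriveEjacobian _ (differentiable_comp df dg)).
by rewrite -(deriveEjacobian _ df) -(deriveEjacobian _ dg) derive_comp.
Qed.

Lemma near_eq_jacobian n m (f g : 'rV[R]_n -> 'rV[R]_m) a :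
  (\near a, f a = g a) -> differentiable f a -> 'J f a = 'J g a.
Proof.
move=> fg df; apply/row_matrixP => i; rewrite [LHS]rowE [RHS]rowE.
have dg := near_eq_differentiable fg df.
rewrite -[LHS](deriveEjacobian _ df) -[RHS](deriveEjacobian _ dg).
exact: near_eq_derive.
Qed.

Lemma jacobian_id n (a : 'rV[R]_n) : 'J id a = 1%:M.
Proof.
apply/row_matrixP => i; rewrite [LHS]rowE [RHS]rowE mulmx1.
by rewrite -[LHS]deriveEjacobian ?derive_id.
Qed.

(** A matrix is the sum of its entries times the elementary matrices, which reduces
    differentiability of a matrix product to that of sums and products of scalars. *)
Lemma differentiable_mx (V : normedModType R) m n (M : V -> 'M[R]_(m, n)) a :
  (forall i j, differentiable (fun u => M u i j) a) -> differentiable M a.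
Proof.
move=> dM.
have -> : M = \sum_i \sum_j (fun u => M u i j *: delta_mx i j).
  apply/funext => u; rewrite [LHS]matrix_sum_delta fct_sumE.
  by apply: eq_bigr => i _; rewrite fct_sumE.
by do 2!apply: differentiable_sum => ?; exact: differentiableZl.
Qed.

Lemma differentiable_entry (V : normedModType R) m n (M : V -> 'M[R]_(m, n)) a
  i j : differentiable M a -> differentiable (fun u => M u i j) a.
Proof.
move=> dM; exact: (differentiable_comp dM (differentiable_coord (M a) i j)).
Qed.

Section mulmx.
Context (V : normedModType R) (m n p : nat).
Variables (M : V -> 'M[R]_(m, n)) (N : V -> 'M[R]_(n, p)) (a : V).
Hypotheses (dM : differentiable M a) (dN : differentiable N a).

Let mulmx_fct i k : (fun u => (M u *m N u) i k) =
  \sum_j (fun u => M u i j) * (fun u => N u j k).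
Proof. by apply/funext => u; rewrite mxE fct_sumE. Qed.

Lemma differentiable_mulmx : differentiable (fun u => M u *m N u) a.
Proof.
apply: differentiable_mx => i k; rewrite mulmx_fct.
by apply: differentiable_sum => j; apply: differentiableM; exact: differentiable_entry.
Qed.

Lemma derive_mulmx v :
  'D_v (fun u => M u *m N u) a = 'D_v M a *m N a + M a *m 'D_v N a.
Proof.
have der (q r : nat) (L : V -> 'M[R]_(q, r)) i j : differentiable L a ->
    derivable (fun u => L u i j) a v.
  by move=> dL; apply: diff_derivable; exact: differentiable_entry.
rewrite !derive_mx; try by apply: diff_derivable => //; exact: differentiable_mulmx.
apply/matrixP => i k; rewrite !mxE mulmx_fct derive_sum => [|j]; last first.
  by apply: derivableM; exact: der.
rewrite -big_split; apply: eq_bigr => j _; rewrite deriveM; try exact: der.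
by rewrite !mxE addrC /GRing.scale /= mulrC.
Qed.

End mulmx.

Lemma derive1_mulmx_comp (V : normedModType R) m n p (M : R -> 'M[R]_(m, n))
    (N : V -> 'M[R]_(n, p)) (f : R -> V) t :
  differentiable M t -> differentiable f t -> differentiable N (f t) ->
  derive1 (fun t => M t *m N (f t)) t =
    derive1 M t *m N (f t) + M t *m 'D_(derive1 f t) N (f t).
Proof.
move=> dM df dN; have dNf := differentiable_comp df dN.
by rewrite !derive1E (derive_mulmx dM dNf) (derive_comp _ df dN).
Qed.

Lemma differentiable_prod (V : normedModType R) (I : Type) (r : seq I)
    (f : I -> V -> R) a :
  (forall i, differentiable (f i) a) ->
  differentiable (fun u => \prod_(i <- r) f i u) a.
Proof.
move=> df; elim: r => [|i r IH].
  by under eq_fun do rewrite big_nil; exact: differentiable_cst.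
by under eq_fun do rewrite big_cons; exact: (differentiableM (df i) IH).
Qed.

(** This makes the determinant continuous along M, so that a matrix which is
    invertible at a point stays invertible nearby. *)
Lemma differentiable_det (V : normedModType R) n (M : V -> 'M[R]_n) a :
  differentiable M a -> differentiable (fun u => \det (M u)) a.
Proof.
move=> dM; rewrite /determinant.
elim: index_enum => [|s r IH].
  by under eq_fun do rewrite big_nil; exact: differentiable_cst.
under eq_fun do rewrite big_cons.
apply: (differentiableD _ IH).
have dp : differentiable (fun u => \prod_i M u i (s i)) a.
  by apply: differentiable_prod => i; exact: differentiable_entry.
exact: (differentiableM (differentiable_cst _ _) dp).
Qed.

Lemma smooth_differentiable (V W : normedModType R) (U : set V) (f : V -> W) u :
  smooth U f -> U u -> differentiable f u.
Proof. by move=> /(_ 1%N) [+ _] Uu; apply. Qed.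

(** The chart expressions of the objects constructed below agree with explicit
    affine maps only on an open set, while the derivatives entering smoothness are
    taken of the total functions. *)
Lemma eq_smooth (V W : normedModType R) (U : set V) (f g : V -> W) :
  open U -> (forall u, U u -> f u = g u) -> smooth U f -> smooth U g.
Proof.
move=> oU + + k; elim: k f g => [|k IH] f g fg fU.
  move=> u Uu; have cf : f @ u --> f u := fU 0%N u Uu.
  suff : g @ u --> g u by []; rewrite -(fg u Uu).
  apply: cvg_trans cf; apply: near_eq_cvg.
  by have /filterS := open_nbhs_nbhs (conj oU Uu); apply => w /fg.
have near_fg u : U u -> \forall w \near u, f w = g w.
  by move=> Uu; have /filterS := open_nbhs_nbhs (conj oU Uu); apply => w /fg.
split => [u Uu|v].
  by apply: (near_eq_differentiable (near_fg u Uu)); have [+ _] := fU 1%N; apply.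
apply: (IH ('D_v f)) => [u Uu|j]; first exact/near_eq_derive/near_fg.
by have [_] := fU j.+1; apply.
Qed.

Lemma smooth_cst (V W : normedModType R) (U : set V) (c : W) :
  smooth U (fun=> c : W).
Proof.
move=> k; elim: k c => [|k IH] c; first by move=> u _; exact: cvg_cst.
split=> [u _|v]; first exact: differentiable_cst.
have -> : 'D_v (fun=> c : W) = (fun=> 0) by apply/funext => u; exact: derive_cst.
exact: IH.
Qed.

(** A map whose directional derivatives are all constant is smooth, because its
    higher derivatives vanish. *)
Lemma smooth_affine (V W : normedModType R) (U : set V) (f : V -> W)
    (df : V -> W) :
  (forall u, differentiable f u) -> (forall u v, 'D_v f u = df v) -> smooth U f.
Proof.
move=> dif der [|k]; first by move=> u _; exact: differentiable_continuous.
split=> // v; have -> : 'D_v f = (fun=> df v) by apply/funext => u; exact: der.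
exact: smooth_cst.
Qed.

(** Continuity of a linear map is automatic in finite dimension, by expansion in
    the standard basis. *)
Lemma differentiable_linear n (W : normedModType R)
    (L : {linear 'rV[R]_n -> W}) a : differentiable L a.
Proof.
have -> : (L : 'rV[R]_n -> W) =
    \sum_i (fun u : 'rV[R]_n => u 0 i *: L (delta_mx 0 i)).
  apply/funext => u; rewrite [u in LHS]row_sum_delta linear_sum fct_sumE.
  by apply: eq_bigr => i _; rewrite linearZ.
apply: differentiable_sum => i; apply: differentiableZl.
exact: differentiable_coord.
Qed.

Lemma derive_linear n (W : normedModType R) (L : {linear 'rV[R]_n -> W}) a v :
  'D_v L a = L v.
Proof.
rewrite deriveE; last exact: differentiable_linear.
rewrite diff_lin // => u; apply: differentiable_continuous.
exact: differentiable_linear.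
Qed.

Section line.
Context (V : normedModType R).
Variables (a v : V).

Lemma differentiable_line t : differentiable (fun t : R => a + t *: v) t.
Proof. by apply: (@differentiableD _ _ _ (fun=> a)). Qed.

Lemma derive_line t w : 'D_w (fun t : R => a + t *: v) t = w *: v.
Proof.
rewrite (@deriveD _ _ _ (fun=> a)) //; last exact: diff_derivable.
by rewrite derive_cst add0r deriveE // diff_val.
Qed.

Lemma smooth_line (U : set R) : smooth U (fun t : R => a + t *: v).
Proof. exact: smooth_affine differentiable_line derive_line. Qed.

Lemma derive1_line t : derive1 (fun t => a + t *: v) t = v.
Proof. by rewrite derive1E derive_line scale1r. Qed.

End line.

End Calculus.

(** * Changing charts *)

Section Charts.
Context (R : realType) (n : nat) (M : manifold R n).
Implicit Types (phi psi : chart R n M) (x y z : M).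

Lemma atlas_chart_at x : atlas (chart_at x).
Proof. by rewrite /chart_at; case: cid => ? []. Qed.

Lemma cdom_chart_at x : cdom (chart_at x) x.
Proof. by rewrite /chart_at; case: cid => ? []. Qed.

Hint Resolve atlas_chart_at cdom_chart_at : core.

Lemma near_cdom phi x : cdom phi x -> \forall y \near x, cdom phi y.
Proof. by move=> px; apply: open_nbhs_nbhs; split => //; exact: open_cdom. Qed.

Lemma near_cinv phi x (P : M -> Prop) : cdom phi x ->
  (\forall y \near x, P y) -> \forall u \near cmap phi x, P (cinv phi u).
Proof.
move=> px nP; have /(cinv_cts (c := phi)) : (cmap phi @` cdom phi) (cmap phi x).
  by exists x.
by apply; rewrite cmapK.
Qed.

Lemma near_cmapK phi x : cdom phi x ->
  \forall u \near cmap phi x, cmap phi (cinv phi u) = u.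
Proof.
move=> px; have : nbhs (cmap phi x) (cmap phi @` cdom phi).
  by apply: open_nbhs_nbhs; split; [exact: open_cimg|exists x].
by apply: filterS => _ [y py <-]; rewrite cmapK.
Qed.

Lemma smooth_in_differentiable (W : normedModType R) phi V (g : M -> W) x :
  smooth_in phi V g -> V x -> differentiable (g \o cinv phi) (cmap phi x).
Proof. by move=> gs Vx; apply: (smooth_differentiable gs); exists x. Qed.

Lemma transition_differentiable phi psi x : atlas phi -> atlas psi ->
  cdom phi x -> cdom psi x -> differentiable (cmap psi \o cinv phi) (cmap phi x).
Proof.
move=> aphi apsi px qx; apply: (smooth_differentiable (atlas_smooth aphi apsi)).
by exists x.
Qed.

Lemma trans_id phi x : cdom phi x -> trans phi phi x = 1%:M.
Proof.
move=> px; rewrite -(jacobian_id (cmap phi x)); apply/esym/near_eq_jacobian => //.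
by apply: filterS (near_cmapK px) => u /= ->.
Qed.

(** The chain rule for the Jacobians of coordinate changes. *)
Lemma trans_comp phi1 phi2 phi3 x :
  atlas phi1 -> atlas phi2 -> atlas phi3 ->
  cdom phi1 x -> cdom phi2 x -> cdom phi3 x ->
  trans phi1 phi2 x *m trans phi2 phi3 x = trans phi1 phi3 x.
Proof.
move=> a1 a2 a3 p1 p2 p3.
have E : cmap phi2 x = (cmap phi2 \o cinv phi1) (cmap phi1 x) by rewrite /= cmapK.
have d12 := transition_differentiable a1 a2 p1 p2.
have := transition_differentiable a2 a3 p2 p3; rewrite /trans E => d23.
rewrite -(jacobian_comp d12 d23); apply: near_eq_jacobian.
  by apply: filterS (near_cinv p1 (near_cdom p2)) => u qu; rewrite /= cmapK.
exact: differentiable_comp d12 d23.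
Qed.

Lemma transV phi psi x : atlas phi -> atlas psi -> cdom phi x -> cdom psi x ->
  trans phi psi x *m trans psi phi x = 1%:M.
Proof. by move=> *; rewrite trans_comp // trans_id. Qed.

(** Smoothness is asserted in some charts around a point; the computation uses
    the preferred chart.  This lemma and [differentiable_rechart2] transfer
    differentiability between the two. *)
Lemma differentiable_rechart (W : normedModType R) (g : M -> W) phi psi x :
  atlas phi -> atlas psi -> cdom phi x -> cdom psi x ->
  differentiable (g \o cinv psi) (cmap psi x) ->
  differentiable (g \o cinv phi) (cmap phi x).
Proof.
move=> aphi apsi px qx dg.
have dt := transition_differentiable aphi apsi px qx.
apply: (@near_eq_differentiable _ _ _
  ((g \o cinv psi) \o (cmap psi \o cinv phi))).
  by apply: filterS (near_cinv px (near_cdom qx)) => u qu; rewrite /= cmapK.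
have e : (cmap psi \o cinv phi) (cmap phi x) = cmap psi x by rewrite /= cmapK.
by rewrite -e in dg; exact: (differentiable_comp dt dg).
Qed.

(** The entries of the Jacobian are first directional derivatives of the coordinate
    change, which are themselves differentiable because transition maps are at least C^2. *)
Lemma trans_differentiable phi psi x : atlas phi -> atlas psi ->
  cdom phi x -> cdom psi x ->
  differentiable (trans phi psi \o cinv phi) (cmap phi x).
Proof.
move=> aphi apsi px qx; apply: differentiable_mx => i j.
set f := cmap psi \o cinv phi.
have [_ /(_ (delta_mx 0 i)) [df _]] := atlas_smooth aphi apsi 2%N.
have {df} df : differentiable ('D_(delta_mx 0 i) f) (cmap phi x).
  by apply: df; exists x.
apply: near_eq_differentiable (differentiable_entry 0 j df).
apply: filterS3 (near_cmapK px) (near_cinv px (near_cdom px))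
  (near_cinv px (near_cdom qx)) => u uK pu qu.
rewrite deriveE; last by rewrite -uK; exact: transition_differentiable.
by rewrite /trans /= uK /jacobian [RHS]mxE.
Qed.

Lemma comp_rechart phi psi x (v : tangent x) : atlas phi -> atlas psi ->
  cdom phi x -> cdom psi x -> Defs.comp psi v = Defs.comp phi v *m trans phi psi x.
Proof. by move=> *; rewrite /Defs.comp -mulmxA trans_comp. Qed.

Lemma comp_chart_at x (v : tangent x) : Defs.comp (chart_at x) v = v.
Proof. by rewrite /Defs.comp trans_id // mulmx1. Qed.

Lemma field_at_differentiable phi x (X : forall y, tangent y) :
  atlas phi -> cdom phi x -> field_at x X ->
  differentiable (fun u => Defs.comp phi (X (cinv phi u))) (cmap phi x).
Proof.
move=> aphi px [U [_ Ux /(_ x Ux) [psi [V [apsi oV Vx VU sX]]]]].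
have qx : cdom psi x by have [] := VU x Vx.
have dX := differentiable_rechart aphi apsi px qx (smooth_in_differentiable sX Vx).
have dT := differentiable_rechart aphi apsi px qx
  (trans_differentiable apsi aphi qx px).
apply: near_eq_differentiable (differentiable_mulmx dX dT).
apply: filterS2 (near_cinv px (near_cdom px)) (near_cinv px (near_cdom qx)).
by move=> u pu qu /=; rewrite -comp_rechart.
Qed.

Lemma differentiable_rechart2 (f : M -> M) phi phi' psi psi' x :
  atlas phi -> atlas phi' -> atlas psi -> atlas psi' ->
  cdom phi x -> cdom phi' x -> cdom psi (f x) ->
  (\forall y \near x, cdom psi' (f y)) ->
  differentiable (cmap psi' \o f \o cinv phi') (cmap phi' x) ->
  differentiable (cmap psi \o f \o cinv phi) (cmap phi x).
Proof.
move=> a a' b b' px px' qx qf df; have qx' := nbhs_singleton qf.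
apply: (differentiable_rechart a a' px px').
apply: (@near_eq_differentiable _ _ _
  ((cmap psi \o cinv psi') \o (cmap psi' \o f \o cinv phi'))).
  by apply: filterS (near_cinv px' qf) => u qu; rewrite /= cmapK.
apply: differentiable_comp => //=; rewrite cmapK //.
exact: transition_differentiable.
Qed.

Lemma smooth_map_differentiable U (f : M -> M) phi psi x :
  atlas phi -> atlas psi -> smooth_map U f -> U x ->
  cdom phi x -> cdom psi (f x) ->
  differentiable (cmap psi \o f \o cinv phi) (cmap phi x).
Proof.
move=> a b sf Ux px qx.
have [phi' [psi' [V [[a' b' oV Vx] [VU fV sV]]]]] := sf x Ux.
have nV : nbhs x V by exact: open_nbhs_nbhs.
apply: (@differentiable_rechart2 _ _ phi' _ psi') => //.
- by have [] := VU x Vx.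
- by apply: filterS nV => y Vy; apply: fV; exists y.
- exact: smooth_in_differentiable sV Vx.
Qed.

(** A map that is smooth in one pair of charts is continuous at x, hence keeps a
    neighbourhood of x inside any chart domain around its value. *)
Lemma near_cdom_image (f : M -> M) phi psi psi' V x : open V -> V x ->
  cdom phi x -> (f @` V `<=` cdom psi) ->
  smooth_in phi V (cmap psi \o f) -> cdom psi' (f x) ->
  \forall y \near x, cdom psi' (f y).
Proof.
move=> oV Vx px fV sV qx'; have nV : nbhs x V by exact: open_nbhs_nbhs.
have qx : cdom psi (f x) by apply: fV; exists x.
have /differentiable_continuous := smooth_in_differentiable sV Vx.
rewrite /prop_for/continuous_at /= (cmapK px) => cf.
have nW := near_cinv qx (near_cdom qx').
have := cmap_cts px (cf _ nW).
apply: filterS3 nV (near_cdom px) => y Vy py /=; rewrite (cmapK py) cmapK //.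
by apply: fV; exists y.
Qed.

Lemma smooth_map_near_cdom U (f : M -> M) psi x : smooth_map U f -> U x ->
  cdom psi (f x) -> \forall y \near x, cdom psi (f y).
Proof.
move=> sf Ux; have [phi' [psi' [V [[_ _ oV Vx] [VU fV sV]]]]] := sf x Ux.
by apply: (near_cdom_image oV Vx _ fV sV); have [] := VU x Vx.
Qed.

Section bisection.
Variables (b : bisection M) (x : M).
Hypothesis bx : bdom b x.

Lemma near_bdom : \forall y \near x, bdom b y.
Proof. by apply: open_nbhs_nbhs; split => //; exact: bdom_open. Qed.

Lemma near_b0 (psi : chart R n M) :
  cdom psi (b0 b x) -> \forall y \near x, cdom psi (b0 b y).
Proof.
have [phi' [psi' [V [[_ _ oV Vx] [VU bV sV _]]]]] := bis_smooth bx.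
by apply: (near_cdom_image oV Vx _ bV sV); have [] := VU x Vx.
Qed.

Lemma read_b0_differentiable phi psi : atlas phi -> atlas psi ->
  cdom phi x -> cdom psi (b0 b x) ->
  differentiable (read_b0 phi psi b) (cmap phi x).
Proof.
move=> a c px qx.
have [phi' [psi' [V [[a' c' oV Vx] [VU bV sV _]]]]] := bis_smooth bx.
apply: (@differentiable_rechart2 (b0 b) _ phi' _ psi') => //.
- by have [] := VU x Vx.
- by apply: near_b0; apply: bV; exists x.
- exact: smooth_in_differentiable sV Vx.
Qed.

(** The transformation law of the matrix of an isomorphism; it reduces the
    differentiability of [read_iso] in arbitrary charts to the charts in which the
    bisection is known to be smooth. *)
Lemma iso_comp_rechart phi psi phi' psi' y : bdom b y ->
  atlas phi -> atlas psi -> atlas phi' -> atlas psi' ->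
  cdom phi y -> cdom phi' y -> cdom psi (b0 b y) -> cdom psi' (b0 b y) ->
  iso_comp phi psi (b y) =
    trans phi phi' y *m iso_comp phi' psi' (b y) *m trans psi' psi (b0 b y).
Proof.
move=> dy a c a' c' p p' q q'; rewrite /iso_comp (bis_src dy).
have e1 := trans_comp a a' (atlas_chart_at y) p p' (cdom_chart_at y).
have e2 := trans_comp (atlas_chart_at _) c' c (cdom_chart_at _) q' q.
by rewrite -[in LHS]e1 -[in LHS]e2 !mulmxA.
Qed.

Lemma read_iso_differentiable phi psi : atlas phi -> atlas psi ->
  cdom phi x -> cdom psi (b0 b x) ->
  differentiable (read_iso phi psi b) (cmap phi x).
Proof.
move=> a c px qx.
have [phi' [psi' [V [[a' c' oV Vx] [VU bV _ sV]]]]] := bis_smooth bx.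
have px' : cdom phi' x by have [] := VU x Vx.
have qx' : cdom psi' (b0 b x) by apply: bV; exists x.
have d1 := trans_differentiable a a' px px'.
have d2 := differentiable_rechart a a' px px' (smooth_in_differentiable sV Vx).
have d3 : differentiable ((trans psi' psi \o b0 b) \o cinv phi) (cmap phi x).
  have e : cmap psi' (b0 b x) = read_b0 phi psi' b (cmap phi x).
    by rewrite /read_b0 cmapK.
  have := trans_differentiable c' c qx' qx; rewrite e => dt.
  have := differentiable_comp (read_b0_differentiable a c' px qx') dt.
  apply: near_eq_differentiable.
  apply: filterS (near_cinv px (near_b0 qx')) => u qu.
  by rewrite /= /read_b0 cmapK.
apply: near_eq_differentiable
  (differentiable_mulmx (differentiable_mulmx d1 d2) d3).
apply: (near_cinv (P := fun y => trans phi phi' y *m iso_comp phi' psi' (b y)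
  *m trans psi' psi (b0 b y) = iso_comp phi psi (b y)) px); near=> y.
rewrite -iso_comp_rechart //.
- by near: y; exact: near_bdom.
- by near: y; exact: near_cdom.
- by near: y; exact: near_cdom.
- by near: y; exact: near_b0.
- by near: y; exact: near_b0.
Unshelve. all: by end_near. Qed.

End bisection.
End Charts.

#[local] Hint Resolve atlas_chart_at cdom_chart_at : core.

(** * The action of a jet on the second tangent bundle *)

Section Prolongation.
Context (R : realType) (n : nat) (M : manifold R n).
Implicit Types (phi psi : chart R n M) (x y z : M) (b : bisection M)
  (XX : TTM M).

Lemma iso_comp_chart_at b x : bdom b x ->
  iso_comp (chart_at x) (chart_at (b0 b x)) (b x) = iso_mx (b x).
Proof.
move=> bx; rewrite /iso_comp (bis_src bx).
by rewrite (trans_id (cdom_chart_at x)) mul1mx trans_id ?mulmx1.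
Qed.

Lemma comp_bact b phi psi y (v : tangent y) : bdom b y ->
  atlas phi -> cdom phi y ->
  Defs.comp psi (tvec (bact b (TVec y v))) = Defs.comp phi v *m iso_comp phi psi (b y).
Proof.
move=> bdy a py; rewrite /iso_comp (bis_src bdy) /Defs.comp /= !mulmxA.
have e := transV (atlas_chart_at y) a (cdom_chart_at y) py.
by congr (_ *m _ *m _); rewrite -mulmxA e mulmx1.
Qed.

(** The components of j^1_x b . (x, X, Y, V): the target component of the derivative
    of b(x_t) X_t is given by the chain rule, the last one by the product rule. *)
Definition prolong b XX : TTM M :=
  let x := ttbase XX in
  let phi := chart_at x in let psi := chart_at (b0 b x) in
  let u0 := cmap phi x in
  TTVec (b0 b x) (ttX XX *m iso_mx (b x))
    ('D_(ttY XX) (read_b0 phi psi b) u0)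
    (ttV XX *m iso_mx (b x) + ttX XX *m 'D_(ttY XX) (read_iso phi psi b) u0).

Lemma smooth_curve_differentiable (c : R -> TM M) : smooth_curve c ->
  let phi := chart_at (tbase (c 0)) in
  differentiable (fun t => cmap phi (tbase (c t))) 0 /\
  differentiable (fun t => Defs.comp phi (tvec (c t))) 0.
Proof.
move=> [e [e0 _ sU sW]] phi.
by split; [apply: (smooth_differentiable sU)|apply: (smooth_differentiable sW)];
  exact: ballxx.
Qed.

Lemma near_curve (c : R -> TM M) (P : M -> Prop) : smooth_curve c ->
  (\forall y \near tbase (c 0), P y) -> \forall t \near 0, P (tbase (c t)).
Proof.
move=> sc nP; have [dU _] := smooth_curve_differentiable sc.
case: sc => e [e0 ce _ _]; set phi := chart_at _ in ce dU.
have n0 : \forall t \near (0 : R), ball 0 e t by exact: nbhsx_ballx.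
have := differentiable_continuous dU (near_cinv (cdom_chart_at _) nP).
by apply: filterS2 n0 => t /ce ct /=; rewrite cmapK.
Qed.

(** In charts, b(x_t) X_t has base components [read_b0] of the components of x_t, and
    vector components equal to those of X_t times [read_iso]; the chain and product
    rules give the components of the velocity. *)
Lemma velocity_bact b (c : R -> TM M) : smooth_curve c -> bdom b (tbase (c 0)) ->
  velocity (bact b \o c) = prolong b (velocity c).
Proof.
move=> sc bx; have [dU dW] := smooth_curve_differentiable sc.
set x := tbase (c 0) in bx; set phi := chart_at x in dU dW.
set psi := chart_at (b0 b x).
have db0 := read_b0_differentiable bx (atlas_chart_at x) (atlas_chart_at (b0 b x))
  (cdom_chart_at x) (cdom_chart_at (b0 b x)).
have diso := read_iso_differentiable bx (atlas_chart_at x)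
  (atlas_chart_at (b0 b x)) (cdom_chart_at x) (cdom_chart_at (b0 b x)).
have nphi := near_curve sc (near_cdom (cdom_chart_at _)).
have nb := near_curve sc (near_bdom bx).
have e1 : derive1 (fun t => cmap psi (b0 b (tbase (c t)))) 0 =
  'D_(derive1 (fun t => cmap phi (tbase (c t))) 0) (read_b0 phi psi b) (cmap phi x).
  rewrite !derive1E -(derive_comp _ dU db0); apply: near_eq_derive.
  by apply: filterS nphi => t pt; rewrite /= /read_b0 cmapK.
have e2 : derive1 (fun t => Defs.comp psi (tvec (bact b (c t)))) 0 =
  derive1 (fun t => Defs.comp phi (tvec (c t))) 0 *m iso_mx (b x) +
  tvec (c 0) *m 'D_(derive1 (fun t => cmap phi (tbase (c t))) 0)
    (read_iso phi psi b) (cmap phi x).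
  have r0 : read_iso phi psi b (cmap phi x) = iso_mx (b x).
    by rewrite /read_iso (cmapK (cdom_chart_at x)); exact: iso_comp_chart_at.
  have w0 : Defs.comp phi (tvec (c 0)) = tvec (c 0) := comp_chart_at (tvec (c 0)).
  have E := derive1_mulmx_comp dW dU diso.
  rewrite r0 w0 in E; apply: etrans E.
  rewrite !derive1E; apply: near_eq_derive; apply: filterS2 nphi nb => t pt bt.
  rewrite /read_iso (cmapK pt).
  case: (c t) pt bt => y v pt bt.
  exact: (comp_bact _ v bt (atlas_chart_at x) pt).
exact: (f_equal2 (TTVec (b0 b x) (tvec (c 0) *m iso_mx (b x))) e1 e2).
Qed.

Lemma TVec_eq y x (v : tangent y) (w : tangent x) :
  y = x -> v = w :> 'rV[R]_n -> TVec y v = TVec x w.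
Proof. by move=> yx; case: _ / yx w => w /= ->. Qed.

Lemma velocity_start (c : R -> TM M) x (X : tangent x) : c 0 = TVec x X ->
  velocity c = TTVec x X (derive1 (fun t => cmap (chart_at x) (tbase (c t))) 0)
    (derive1 (fun t => Defs.comp (chart_at x) (tvec (c t))) 0).
Proof. by rewrite /velocity => ->. Qed.

(** Every second tangent vector is the velocity of a curve that is affine in the
    chart of TM, so that the action of jets is not vacuous. *)
Lemma exists_curve XX : exists c, smooth_curve c /\ velocity c = XX.
Proof.
case: XX => x X Y V; set phi := chart_at x.
have px : cdom phi x := cdom_chart_at x.
have aphi : atlas phi := atlas_chart_at x.
pose p (t : R) := cinv phi (cmap phi x + t *: Y).
pose c t := TVec (p t) ((X + t *: V) *m trans phi (chart_at (p t)) (p t)).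
have p0 : p 0 = x by rewrite /p scale0r addr0 cmapK.
have c0 : c 0 = TVec x X.
  apply: TVec_eq => //; rewrite scale0r addr0 p0.
  by rewrite (trans_id px) mulmx1.
have : \forall t \near (0 : R),
    (cmap phi @` cdom phi) (cmap phi x + t *: Y).
  have : {for 0, continuous (fun t : R => cmap phi x + t *: Y)}.
    exact/differentiable_continuous/differentiable_line.
  apply; rewrite scale0r addr0; apply: open_nbhs_nbhs.
  by split; [exact: open_cimg|exists x].
move=> /nbhs_ballP [e e0 ballW].
have pW t : ball 0 e t -> cdom phi (p t) /\ cmap phi (p t) = cmap phi x + t *: Y.
  by move=> /ballW [y py E]; rewrite /p -E cmapK.
have cW t : ball 0 e t -> Defs.comp phi (tvec (c t)) = X + t *: V.
  move=> /pW [pt _]; rewrite /Defs.comp /= -mulmxA.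
  have e1 := transV aphi (atlas_chart_at (p t)) pt (cdom_chart_at _).
  by rewrite e1 mulmx1.
exists c; split.
  rewrite /smooth_curve c0; exists e; split=> //.
  - by move=> t /pW [].
  - apply: (eq_smooth _ _ (smooth_line (cmap phi x) Y (ball 0 e))).
      exact: ball_open.
    by move=> t /pW [_ ->].
  - apply: (eq_smooth _ _ (smooth_line X V (ball 0 e))).
      exact: ball_open.
    by move=> t /cW ->.
have n0 : \forall t \near (0 : R), ball 0 e t by exact: nbhsx_ballx.
rewrite (velocity_start c0) -/phi.
have -> : derive1 (fun t => cmap phi (tbase (c t))) 0 = Y.
  rewrite -[RHS](derive1_line (cmap phi x) Y 0) !derive1E; apply: near_eq_derive.
  by apply: filterS n0 => t /pW [_ ->].
have -> // : derive1 (fun t => Defs.comp phi (tvec (c t))) 0 = V.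
rewrite -[RHS](derive1_line X V 0) !derive1E; apply: near_eq_derive.
by apply: filterS n0 => t /cW ->.
Qed.

Lemma jrepP (eta : jet11 M) : bdom (jrep eta) (jsrc eta) /\
  jcls eta = jet_eq (jsrc eta) (jrep eta).
Proof. by rewrite /jrep; case: cid. Qed.

(** The velocity of b(x_t) X_t depends on the curve only through its own velocity,
    so the value of [jact] does not depend on the choice of the curve. *)
Lemma jactE eta XX : ttbase XX = jsrc eta -> jact eta XX = prolong (jrep eta) XX.
Proof.
move=> src; have [bx _] := jrepP eta.
have vel c : smooth_curve c -> velocity c = XX ->
    velocity (bact (jrep eta) \o c) = prolong (jrep eta) XX.
  move=> sc cXX; rewrite velocity_bact ?cXX //.
  by rewrite -[tbase _]/(ttbase (velocity c)) cXX src.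
rewrite /jact; apply: xget_unique => [|_ [c [sc cXX <-]]]; last exact: vel.
by have [c [sc cXX]] := exists_curve XX; exists c; split=> //; exact: vel.
Qed.

Lemma jrep_j1 b x (bx : bdom b x) : jet_eq x (jrep (j1 bx)) b.
Proof.
have [_ /= <-] := jrepP (j1 bx).
by split.
Qed.

End Prolongation.

(** * Bisections with a prescribed jet *)

Section Reflection.
Context (R : realType) (n : nat) (M : manifold R n).
Implicit Types (phi psi : chart R n M) (x y z : M) (b : bisection M)
  (XX : TTM M).

(** A total constructor: on a singular matrix it falls back on -I_y, so that the
    section below can be defined on all of M without carrying a proof of
    invertibility. *)
Definition iso_or_negI y z (m : 'M[R]_n) : B1 M :=
  match @idP (m \in unitmx) with
  | ReflectT h => Iso y z h
  | ReflectF _ => negI y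
  end.

Lemma iso_or_negIP y z m : m \in unitmx ->
  [/\ iso_src (iso_or_negI y z m) = y, iso_tgt (iso_or_negI y z m) = z &
      iso_mx (iso_or_negI y z m) = m].
Proof. by rewrite /iso_or_negI; case: {-}_ / idP. Qed.

Lemma trans_unit phi psi x : atlas phi -> atlas psi -> cdom phi x ->
  cdom psi x -> trans phi psi x \in unitmx.
Proof.
by move=> a c px qx; exact: (mulmx1_unit (transV a c px qx)).1.
Qed.

Section construction.
Variables (x : M) (L : {linear 'rV[R]_n -> 'M[R]_n}).
Let phi := chart_at x.
Let u0 := cmap phi x.
Let px : cdom phi x := cdom_chart_at x.
Let aphi : atlas phi := atlas_chart_at x.
(* the matrix of the bisection to be built, in the components of phi *)
Let N u : 'M[R]_n := - 1%:M + L (u - u0).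

Let differentiable_N u : differentiable N u.
Proof.
apply: (@differentiableD _ _ _ (fun=> - 1%:M)) => //.
apply: (@differentiable_comp _ _ _ _ (fun u => u - u0) L).
  exact: differentiableB.
exact: differentiable_linear.
Qed.

Let derive_N u v : 'D_v N u = L v.
Proof.
have dB : differentiable (fun u => u - u0) u by exact: differentiableB.
have dL := differentiable_linear L (u - u0).
rewrite (@deriveD _ _ _ (fun=> - 1%:M)) //; last first.
  exact/diff_derivable/(differentiable_comp dB dL).
rewrite derive_cst add0r (derive_comp v dB dL) derive_linear deriveB //.
by rewrite derive_id derive_cst subr0.
Qed.

(* its base map, in the coordinates of phi *)
Let rho u : 'rV[R]_n := u0 + u0 - u.

Let differentiable_rho u : differentiable rho u.
Proof. exact: differentiableB. Qed.

Let derive_rho u v : 'D_v rho u = - v.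
Proof.
by rewrite (@deriveB _ _ _ (fun=> u0 + u0)) // derive_cst derive_id sub0r.
Qed.

Let smooth_N U : smooth U N.
Proof. exact: smooth_affine differentiable_N derive_N. Qed.

Let smooth_rho U : smooth U rho.
Proof. exact: smooth_affine differentiable_rho derive_rho. Qed.

Let exists_radius : exists2 e : R, 0 < e & forall u, ball u0 e u ->
  (cmap phi @` cdom phi) u /\ N u \in unitmx.
Proof.
have nimg : \forall u \near u0, (cmap phi @` cdom phi) u.
  by apply: open_nbhs_nbhs; split; [exact: open_cimg|exists x].
have ndet : \forall u \near u0, \det (N u) != 0.
  have /differentiable_continuous cdet := differentiable_det (differentiable_N u0).
  have nz : nbhs (\det (N u0)) [set c : R | c != 0].
    apply: open_nbhs_nbhs; split; first exact: open_neq.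
    by rewrite /N subrr linear0 addr0 /= -unitfE -unitmxE opp_unit.
  exact: cdet nz.
have : \forall u \near u0, (cmap phi @` cdom phi) u /\ \det (N u) != 0.
  exact: filterI.
move=> /nbhs_ballP [e e0 eW].
by exists e => // u /eW [? ?]; split => //; rewrite unitmxE unitfE.
Qed.

(** In the chart at x take u |-> 2 u0 - u as base map and -1 + L (u - u0) as matrix.
    On a small ball around u0 the matrix stays invertible; the ball is symmetric and
    the base map is an involution of it, so it is its own inverse and the image of
    the domain is the domain itself. *)
Lemma exists_reflection : exists b, [/\ bdom b x, b0 b x = x,
   iso_mx (b x) = - 1%:M,
   forall v, 'D_v (read_b0 phi phi b) u0 = - v &
   forall v, 'D_v (read_iso phi phi b) u0 = L v].
Proof.
have [e e0 eW] := exists_radius.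
pose D := [set y | cdom phi y /\ ball u0 e (cmap phi y)].
pose r y := cinv phi (rho (cmap phi y)).
have ball_rho u : ball u0 e u -> ball u0 e (rho u).
  have -> : rho u = u0 + (u0 - u) by rewrite /rho addrA.
  by rewrite -ball_normE /= opprD addNKr normrN.
have cball u : ball u0 e u -> D (cinv phi u) /\ cmap phi (cinv phi u) = u.
  by move=> bu; have [[y py E] _] := eW u bu; case: u / E bu => bu; rewrite cmapK.
have rD y : D y -> D (r y) /\ cmap phi (r y) = rho (cmap phi y).
  by move=> [_ /ball_rho/cball].
have rK y : D y -> r (r y) = y.
  move=> Dy; rewrite {1}/r (rD y Dy).2 /rho subKr cmapK //.
  by case: Dy.
have Dx : D x by split => //; exact: ballxx.
have rx : r x = x by rewrite /r /rho addrK cmapK.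
have oD : open D.
  rewrite openE => y [py by0]; apply: filterI; first exact: near_cdom.
  by apply: (cmap_cts py); apply: open_nbhs_nbhs; split => //; exact: ball_open.
have imD : cmap phi @` D = ball u0 e.
  apply/seteqP; split=> [_ [y [_ ?] <-] //|u /cball[Du uK]].
  by exists (cinv phi u).
have imr : r @` D = D.
  apply/seteqP; split=> [_ [y /rD[? _] <-] //|y Dy].
  by exists (r y); [case: (rD y Dy)|exact: rK].
pose m y := trans (chart_at y) phi y *m N (cmap phi y) *m
  trans phi (chart_at (r y)) (r y).
pose b y := iso_or_negI y (r y) (m y).
have bP y : D y -> [/\ iso_src (b y) = y, iso_tgt (b y) = r y & iso_mx (b y) = m y].
  move=> Dy; apply: iso_or_negIP; have [[py /eW[_ Ny]] [[pr _] _]] := (Dy, rD y Dy).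
  have t1 := trans_unit (atlas_chart_at y) aphi (cdom_chart_at y) py.
  have t2 := trans_unit aphi (atlas_chart_at (r y)) pr (cdom_chart_at (r y)).
  rewrite /m 2!unitmx_mul; apply/andP; split; last exact: t2.
  by apply/andP; split; [exact: t1|exact: Ny].
have bt y : D y -> iso_tgt (b y) = r y by case/bP.
have smooth_r : smooth_in phi D (cmap phi \o r).
  rewrite /smooth_in imD; apply: (eq_smooth _ _ (smooth_rho _)).
    exact: ball_open.
  by move=> u /cball[Du uK]; rewrite /= (rD _ Du).2 uK.
have iso_b y : D y -> iso_comp phi phi (b y) = N (cmap phi y).
  move=> Dy; have [bs bt' bm] := bP y Dy; rewrite /iso_comp bs bt' bm /m.
  have [[py _] [[pr _] _]] := (Dy, rD y Dy).
  have e1 := transV aphi (atlas_chart_at y) py (cdom_chart_at y).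
  have e2 := transV aphi (atlas_chart_at (r y)) pr (cdom_chart_at (r y)).
  by rewrite !mulmxA e1 mul1mx -mulmxA e2 mulmx1.
have bsm : smooth_iso_section D b.
  move=> y Dy; exists phi, phi, D; split; first by split.
  split.
  - by move=> z Dz; split => //; case: Dz.
  - by move=> _ [z Dz <-]; rewrite /= (bt z Dz); case: (rD z Dz) => [[]].
  - apply: (eq_smooth _ _ smooth_r); first by rewrite imD; exact: ball_open.
    by rewrite imD => u /cball[Du _]; rewrite /= (bt _ Du).
  - rewrite /smooth_in imD; apply: (eq_smooth _ _ (smooth_N _)).
      exact: ball_open.
    by move=> u /cball[Du uK]; rewrite /= iso_b ?uK.
have imb : (@iso_tgt R n M \o b) @` D = D.
  rewrite -[RHS]imr; apply/seteqP.
  by split => _ [y Dy <-]; exists y => //; rewrite /= (bt y Dy).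
have rsm : smooth_map ((@iso_tgt R n M \o b) @` D) r.
  rewrite imb => y Dy; exists phi, phi, D; split; first by split.
  split => //; first by move=> z Dz; split => //; case: Dz.
  by rewrite imr => z [].
have obm : open ((@iso_tgt R n M \o b) @` D) by rewrite imb.
have bsrc y : D y -> iso_src (b y) = y by case/bP.
have btK y : D y -> r (iso_tgt (b y)) = y.
  by move=> Dy; have [_ -> _] := bP y Dy; exact: rK.
exists (Bisection oD bsrc bsm obm btK rsm); have [bxs bxt bxm] := bP x Dx.
have nD : \forall u \near u0, D (cinv phi u) /\ cmap phi (cinv phi u) = u.
  apply: filterS cball _; exact: nbhsx_ballx.
split => //=.
- by rewrite /b0 /= bxt.
- rewrite bxm /m rx (trans_id px) mulmx1 mul1mx.
  by rewrite /N subrr linear0 addr0.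
- move=> v; rewrite -(derive_rho u0 v); apply: near_eq_derive.
  apply: filterS nD => u [Du uK].
  by rewrite /read_b0 /b0 /= (bt _ Du) (rD _ Du).2 uK.
- move=> v; rewrite -(derive_N u0 v); apply: near_eq_derive.
  by apply: filterS nD => u [Du uK]; rewrite /read_iso /= iso_b ?uK.
Qed.

End construction.
End Reflection.

(** * Symmetry jets and their images under kappa *)

Section JetsReflecting.
Context (R : realType) (n : nat) (M : manifold R n).
Implicit Types (phi psi : chart R n M) (x y z : M) (b : bisection M)
  (XX : TTM M).

(** The derivative beta(v) of the introduction: for a bisection that fixes x, source
    and target are both read in [chart_at x]. *)
Definition iso_jet b x (v : 'rV[R]_n) : 'M[R]_n :=
  'D_v (read_iso (chart_at x) (chart_at x) b) (cmap (chart_at x) x).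

(** The jet of b at x satisfies p = p_* = -I_x. *)
Definition reflects b x : Prop :=
  [/\ bdom b x, b0 b x = x, iso_mx (b x) = - 1%:M &
      forall v, 'D_v (read_b0 (chart_at x) (chart_at x) b) (cmap (chart_at x) x) = - v].

Lemma fixed_read_differentiable b x : bdom b x -> b0 b x = x ->
  differentiable (read_b0 (chart_at x) (chart_at x) b) (cmap (chart_at x) x) /\
  differentiable (read_iso (chart_at x) (chart_at x) b) (cmap (chart_at x) x).
Proof.
move=> bx bxx; have px : cdom (chart_at x) (b0 b x) by rewrite bxx.
by split; [apply: read_b0_differentiable|apply: read_iso_differentiable].
Qed.

Lemma prolong_reflects b x (X Y : tangent x) (V : 'rV[R]_n) : reflects b x ->
  prolong b (TTVec x X Y V) = TTVec x (- X) (- Y) (- V + X *m iso_jet b x Y).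
Proof.
case=> bx bxx mx db; rewrite /prolong /= bxx mx db.
by rewrite !mulmxN !mulmx1.
Qed.

Lemma jet_eq_reflects b b' x : jet_eq x b b' -> reflects b' x ->
  reflects b x /\ forall v, iso_jet b x v = iso_jet b' x v.
Proof.
case=> bx bx' bb' /= D [_ bxx mx db'].
have bxx' : b0 b x = x by rewrite /b0 bb'.
rewrite bxx' in D; split=> [|v]; last by case: (D v).
by split; rewrite ?bb' // => v; rewrite (D v).1.
Qed.

Lemma sym_reflects (s : symmetry_jet M) x : reflects (jrep (s x)) x.
Proof.
have [+ _] := jrepP (s x); rewrite sym_src => bx.
have := sym_negI s x; rewrite /jp sym_src => bxE.
have bxx : b0 (jrep (s x)) x = x by rewrite /b0 bxE.
have := sym_semiholonomic s x.
rewrite /semiholonomic /jpstar sym_negI sym_src bxx /= => J.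
split=> // [|v]; first by rewrite bxE.
rewrite deriveEjacobian; last first.
  exact: (fixed_read_differentiable bx bxx).1.
by rewrite -J mulmxN mulmx1.
Qed.

Lemma reflects_jacobian b x : reflects b x ->
  'J (read_b0 (chart_at x) (chart_at x) b) (cmap (chart_at x) x) = - 1%:M.
Proof.
case=> bx bxx _ db; apply/row_matrixP => i; rewrite [LHS]rowE [RHS]rowE.
rewrite -[LHS]deriveEjacobian ?db ?mulmxN ?mulmx1 //.
exact: (fixed_read_differentiable bx bxx).1.
Qed.

(** The candidate is the jet of the bisection with matrix derivative
    Y |-> (X |-> Y beta(X)).  This is linear in Y because matrix multiplication is,
    and each value is linear in X because beta is a differential. *)
Lemma jkappa_exists (eta : jet11 M) : reflects (jrep eta) (jsrc eta) ->
  exists eta' : jet11 M, [/\ jsrc eta' = jsrc eta, semiholonomic eta' &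
    forall XX, ttbase XX = jsrc eta ->
      jact eta' XX = ttkappa (jact eta (ttkappa XX))].
Proof.
set b := jrep eta; set x := jsrc eta => rb; have [bx bxx _ _] := rb.
set phi := chart_at x.
have [_ dI] := fixed_read_differentiable bx bxx.
pose L (Y : 'rV[R]_n) : 'M[R]_n :=
  lin1_mx (mulmx Y \o 'd (read_iso phi phi b) (cmap phi x)).
(* the rows of L Y are the values of the linear map X |-> Y beta(X) *)
have LE X Y : X *m L Y = Y *m 'd (read_iso phi phi b) (cmap phi x) X.
  exact: mul_rV_lin1.
have linL : linear L.
  move=> a Y Y'; apply/row_matrixP => i; rewrite [LHS]rowE [RHS]rowE LE.
  by rewrite mulmxDl mulmxDr -scalemxAl -scalemxAr !LE.
pose L' : {linear 'rV[R]_n -> 'M[R]_n} :=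
  HB.pack L (GRing.isLinear.Build _ _ _ _ L linL).
have [b' [bx' bxx' mx' db' dI']] := exists_reflection x L'.
have rb' : reflects b' x by split; assumption.
have jb := jrep_j1 bx'.
have [rj dj] := jet_eq_reflects jb rb'.
exists (j1 bx'); split => //.
- rewrite /semiholonomic /jp /jpstar /=; case: (rj) => _ -> -> _.
  by rewrite reflects_jacobian.
- case=> y X Y V /= yx; subst y.
  have e : X *m iso_jet b' x Y = Y *m iso_jet b x X.
    by rewrite [iso_jet b' x Y]dI' [iso_jet b x X](deriveE _ dI); exact: LE.
  have e1 := @jactE _ _ _ (j1 bx') (TTVec x X Y V) erefl.
  have e2 := @jactE _ _ _ eta (TTVec x Y X V) erefl.
  rewrite [LHS]e1 (prolong_reflects _ _ _ rj) dj e.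
  rewrite -[ttkappa (TTVec _ _ _ _)]/(TTVec x Y X V) [X in ttkappa X]e2.
  have e3 := prolong_reflects Y X V rb.
  by rewrite [X in ttkappa X]e3; reflexivity.
Qed.

Lemma jkappaE (s : symmetry_jet M) XX :
  jact (jkappa (s (ttbase XX))) XX =
  ttkappa (jact (s (ttbase XX)) (ttkappa XX)).
Proof.
set x := ttbase XX.
have ex : exists eta' : jet11 M, [/\ jsrc eta' = jsrc (s x), semiholonomic eta' &
    forall XX, ttbase XX = jsrc (s x) ->
      jact eta' XX = ttkappa (jact (s x) (ttkappa XX))].
  by apply: jkappa_exists; rewrite sym_src; exact: sym_reflects.
by have [_ _] := xgetPex (s x) ex; apply; rewrite sym_src.
Qed.

End JetsReflecting.

(** * The connection and its torsion in the chart *)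

Section Torsion.
Context (R : realType) (n : nat) (M : manifold R n).
Implicit Types (phi psi : chart R n M) (x y z : M) (b : bisection M)
  (X Y : forall y : M, tangent y).

Definition read_field x X (u : 'rV[R]_n) : 'rV[R]_n :=
  Defs.comp (chart_at x) (X (cinv (chart_at x) u)).

Lemma read_field_at x X : read_field x X (cmap (chart_at x) x) = X x.
Proof. by rewrite /read_field (cmapK (cdom_chart_at x)); exact: comp_chart_at. Qed.

Lemma read_field_differentiable x X : field_at x X ->
  differentiable (read_field x X) (cmap (chart_at x) x).
Proof. exact: field_at_differentiable. Qed.

Lemma bracketE X Y x : bracket X Y x =
  'D_(X x) (read_field x Y) (cmap (chart_at x) x) -
  'D_(Y x) (read_field x X) (cmap (chart_at x) x).
Proof.
rewrite -[bracket _ _ _]/(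
  'D_(read_field x X (cmap (chart_at x) x)) (read_field x Y) (cmap (chart_at x) x)
  - 'D_(read_field x Y (cmap (chart_at x) x)) (read_field x X) (cmap (chart_at x) x)).
by rewrite !read_field_at.
Qed.

Lemma push_at b x X : reflects b x -> push b X x = - X x.
Proof.
case=> bx bxx mx _; have vx : binv b x = x by rewrite -{1}bxx; exact: bisK.
by rewrite /push vx mx mulmxN mulmx1.
Qed.

(** Near x, s_x X is the composite of the product F of the components of X and the
    matrix of b with the coordinate expression g of the inverse of the base map.
    Since g is inverse to a map with derivative -1 at its fixed point u0, its
    derivative is -1 as well, and D_v (F o g) = - D_v F; the product rule for F, with
    matrix value -1 at u0, gives the result. *)
Lemma derive_push b x X v : reflects b x -> field_at x X ->
  differentiable (read_field x (push b X)) (cmap (chart_at x) x) /\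
  'D_v (read_field x (push b X)) (cmap (chart_at x) x) =
  'D_v (read_field x X) (cmap (chart_at x) x) - X x *m iso_jet b x v.
Proof.
move=> rb fX; have [bx bxx mx db] := rb.
set phi := chart_at x; set u0 := cmap phi x.
have px : cdom phi x := cdom_chart_at x.
have aphi : atlas phi := atlas_chart_at x.
have vx : binv b x = x by rewrite -{1}bxx; exact: bisK.
have pvx : cdom phi (binv b x) by rewrite vx.
have imx : ((@iso_tgt R n M \o b) @` bdom b) x by exists x.
pose g := cmap phi \o binv b \o cinv phi.
pose I := read_iso phi phi b.
have dg : differentiable g u0.
  exact: (smooth_map_differentiable aphi aphi (@binv_smooth _ _ _ b) imx px pvx).
have g0 : g u0 = u0 by rewrite /g /= /u0 (cmapK px) vx.
have [dread dI] := fixed_read_differentiable bx bxx.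
have dX := read_field_differentiable fX.
have nim : \forall z \near x, exists y, [/\ bdom b y, b0 b y = z & binv b z = y].
  apply: filterS (open_nbhs_nbhs (conj (@bimg_open _ _ _ b) imx)) => _ [y dy <-].
  by exists y; split => //; exact: bisK.
have npv := smooth_map_near_cdom (@binv_smooth _ _ _ b) imx pvx.
have gv : 'D_v g u0 = - v.
  have dr : differentiable (read_b0 phi phi b) (g u0) by rewrite g0.
  have := derive_comp v dg dr; rewrite g0 db.
  have -> : 'D_v (read_b0 phi phi b \o g) u0 = v.
    rewrite -[RHS](derive_id u0 v); apply: near_eq_derive.
    near=> u; have [y [dy by_ vy]] : exists y, [/\ bdom b y, b0 b y = cinv phi u &
        binv b (cinv phi u) = y] by near: u; exact: (near_cinv px nim).
    have py : cdom phi y by rewrite -vy; near: u; exact: (near_cinv px npv).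
    rewrite /g /read_b0 /= vy (cmapK py) by_.
    by near: u; exact: near_cmapK.
  by move=> e; rewrite [in RHS]e opprK.
pose F u := read_field x X u *m I u.
have dF : differentiable F u0 := differentiable_mulmx dX dI.
have dFg : differentiable F (g u0) by rewrite g0.
have near_push : \forall u \near u0,
    (F \o g) u = read_field x (push b X) u.
  near=> u; have [y [dy by_ vy]] : exists y, [/\ bdom b y, b0 b y = cinv phi u &
      binv b (cinv phi u) = y] by near: u; exact: (near_cinv px nim).
  have py : cdom phi y by rewrite -vy; near: u; exact: (near_cinv px npv).
  rewrite /F /g /I /read_field /read_iso /= vy -/phi (cmapK py) -by_.
  rewrite -(comp_bact phi (X y) dy aphi py).
  have -> // : push b X (b0 b y) = tvec (bact b (TVec y (X y))).
  by rewrite /push bisK.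
split.
  exact: near_eq_differentiable near_push (differentiable_comp dg dFg).
have I0 : I u0 = - 1%:M.
  have := iso_comp_chart_at bx; rewrite bxx mx => <-.
  by rewrite /I /read_iso /u0 (cmapK px).
have X0 : read_field x X u0 = X x := read_field_at x X.
have D : 'D_(- v) F u0 = 'D_(- v) (read_field x X) u0 *m I u0 +
    X x *m 'D_(- v) I u0 by rewrite -X0; exact: derive_mulmx dX dI _.
have EN (W : normedModType R) (f : 'rV[R]_n -> W) :
    differentiable f u0 -> 'D_(- v) f u0 = - 'D_v f u0.
  by move=> df; rewrite !(deriveE _ df) linearN.
rewrite I0 (EN _ _ dX) (EN _ _ dI) mulmxN mulmx1 opprK mulmxN in D.
have <- := near_eq_derive v near_push.
by have -> := derive_comp v dg dFg; rewrite gv g0.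
Unshelve. all: by end_near. Qed.

(** Y + s_x Y vanishes at x, which removes the term of the bracket that
    differentiates X, and the two copies of D_X Y absorb the factor 1/2. *)
Lemma nablaE (s : symmetry_jet M) x X Y : field_at x Y ->
  nabla s X Y x = 'D_(X x) (read_field x Y) (cmap (chart_at x) x) -
    2^-1 *: (Y x *m iso_jet (jrep (s x)) x (X x)).
Proof.
move=> fY; set b := jrep (s x); have rb : reflects b x := sym_reflects s x.
have [dP DP] := derive_push (X x) rb fY.
have dY := read_field_differentiable fY.
rewrite /nabla bracketE -/b (push_at Y rb) (subrr (Y x)) derive0 subr0.
have -> : read_field x (fun z => Y z + push b Y z) =
    read_field x Y + read_field x (push b Y).
  by apply/funext => u; exact: mulmxDl.
rewrite deriveD; try exact: diff_derivable.
rewrite DP addrA scalerBr scalerDr; congr (_ - _).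
by rewrite -mulr2n -scaler_nat scalerA divff ?scale1r ?pnatr_eq0.
Qed.

(** On the domain of [chart_at x], the field whose components in this chart are
    constant. *)
Definition const_field x (v : tangent x) : forall y, tangent y :=
  fun y => (v : 'rV[R]_n) *m trans (chart_at x) (chart_at y) y.

Lemma const_field_at x (v : tangent x) : const_field v x = v.
Proof. by rewrite /const_field (trans_id (cdom_chart_at x)) mulmx1. Qed.

Lemma field_at_const x (v : tangent x) : field_at x (const_field v).
Proof.
set phi := chart_at x; have px : cdom phi x := cdom_chart_at x.
have aphi : atlas phi := atlas_chart_at x.
exists (cdom phi); split; [exact: open_cdom|by []|].
move=> y py; exists phi, (cdom phi); split=> //; first exact: open_cdom.
apply: (eq_smooth _ _ (smooth_cst _ (v : 'rV[R]_n))); first exact: open_cimg.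
move=> _ [z pz <-] /=; rewrite (cmapK pz) /Defs.comp /const_field -mulmxA.
by rewrite (transV aphi (atlas_chart_at z) pz (cdom_chart_at z)) mulmx1.
Qed.

Let antisymmetrize (V : zmodType) (a c p q : V) :
  a - p - (c - q) - (a - c) = q - p.
Proof. by rewrite (opprB c) (addrC q) addrACA (addrC (a - c)) addrK addrC. Qed.

(** The value does not depend on the extensions of v and w, since the derivatives
    of the fields cancel; extensions exist by taking constant components. *)
Lemma torsionE (s : symmetry_jet M) x (v w : tangent x) :
  let beta := iso_jet (jrep (s x)) x in
  torsion (nabla s) v w = 2^-1 *: (v *m beta w - w *m beta v).
Proof.
move=> beta.
have val X Y : field_at x X -> field_at x Y -> X x = v -> Y x = w ->
    nabla s X Y x - nabla s Y X x - bracket X Y x =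
    2^-1 *: (v *m beta w - w *m beta v).
  move=> fX fY Xv Yw; rewrite (nablaE s X fY) (nablaE s Y fX) bracketE Xv Yw.
  by rewrite scalerBr; exact: antisymmetrize.
apply: xget_unique => [|_ [X [Y [fX fY Xv Yw ->]]]]; last exact: val.
exists (const_field v), (const_field w).
have [fv fw] := (field_at_const v, field_at_const w).
by split; rewrite ?val // const_field_at.
Qed.

End Torsion.

Theorem corollary4p2 (R : realType) (n : nat) (M : manifold R n)
    (s : symmetry_jet M) (x : M) (Xx Yx : tangent x) (XX : TTM M) :
  ttp XX = TVec x Yx -> ttpstar XX = TVec x Xx ->
  let A := jact (jkappa (s x)) XX in
  let B := jact (s x) XX in
  [/\ ttp A = ttp B, ttpstar A = ttpstar B &
      TVec x (torsion (nabla s) Xx Yx) = TVec (ttbase A) (2^-1 *: ttpi A B)].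
Proof.
case: XX => z X Y V eX eY.
have zx : z = x := congr1 (@tbase R n M) eX; subst z.
have {eX} -> : X = Yx := congr1 (fun v : TM M => tvec v : 'rV[R]_n) eX.
have {eY} -> : Y = Xx := congr1 (fun v : TM M => tvec v : 'rV[R]_n) eY.
have rs := sym_reflects s x.
have src : x = jsrc (s x) by rewrite sym_src.
have -> : jact (jkappa (s x)) (TTVec x Yx Xx V) = TTVec x (- Yx) (- Xx)
    (- V + Xx *m iso_jet (jrep (s x)) x Yx).
  have -> := jkappaE s (TTVec x Yx Xx V).
  have -> := @jactE _ _ _ (s x) (TTVec x Xx Yx V) src.
  by rewrite (prolong_reflects _ _ _ rs).
have -> : jact (s x) (TTVec x Yx Xx V) = TTVec x (- Yx) (- Xx)
    (- V + Yx *m iso_jet (jrep (s x)) x Xx).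
  have -> := @jactE _ _ _ (s x) (TTVec x Yx Xx V) src.
  exact: prolong_reflects.
move=> A B; split.
- exact: (erefl (TVec x (- Yx))).
- exact: (erefl (TVec x (- Xx))).
rewrite torsionE /A /B /ttpi /=.
by rewrite opprD opprK addrACA addNr add0r.
Qed.
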